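(* Let $k$ be a field and let $\mathfrak{w}$ be the variety of Binary-Lie algebras over $k$ defined by the identities $$x^2=0,\qquad J(x,y,zu)=0,$$ where $J(x,y,z)=(xy)z+(yz)x+(zx)y$. Then: 1. $\mathfrak{w}$ is not a variety of Malcev algebras, i.e. there is an algebra in $\mathfrak{w}$ that is not a Malcev algebra. 2. Every algebra of $\mathfrak{w}$ satisfies the analog of the Moufang Theorem: if $A\in\mathfrak{w}$ and $x_1,x_2,x_3\in A$ satisfy $J(x_1,x_2,x_3)=0$, then the subalgebra of $A$ generated by $x_1,x_2,x_3$ is a Lie algebra.
   Context: All algebras are (not necessarily associative, not necessarily finite-dimensional) algebras over a field $k$: vector spaces with a bilinear product $(x,y)\mapsto xy$. For elements $x,y,z$ of such an algebra, $J(x,y,z)=(xy)z+(yz)x+(zx)y$. A Binary-Lie algebra is an algebra satisfying the identities $x^2=0$ and $J(x,y,xy)=0$. A Malcev algebra is an algebra satisfying the identities $x^2=0$ and $J(x,y,xz)=J(x,y,z)x$. A Lie algebra is an algebra satisfying $x^2=0$ and $J(x,y,z)=0$. The variety defined by a set of identities is the class of all algebras over $k$ satisfying them; the identities $x^2=0$, $J(x,y,zu)=0$ are required for all elements $x,y,z,u$ of the algebra. *)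

(* Defs.v *)
From HB Require Import structures.
From mathcomp Require Import all_boot all_order all_algebra.
From mathcomp Require Import boolp classical_sets.

Set Implicit Arguments.
Unset Strict Implicit.
Unset Printing Implicit Defensive.

Import GRing.Theory.

Local Open Scope classical_set_scope.
Local Open Scope ring_scope.

(* Algebras in the nonassociative sense: no associativity, unit or finite
   dimension is assumed. *)
Record algebra (k : fieldType) := NonassocAlgebra {
  alg_lmod :> lmodType k;
  alg_mul : {bilinear alg_lmod -> alg_lmod -> alg_lmod}
}.

Arguments alg_mul {k} a.

Notation "x ** y" := (alg_mul _ x y) (at level 40, left associativity).

Section Identities.
Variables (k : fieldType) (A : algebra k).
Implicit Types x y z u : A.

Definition jac x y z : A := (x ** y) ** z + (y ** z) ** x + (z ** x) ** y.

Definition square_zero : Prop := forall x, x ** x = 0.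

Definition binary_lie : Prop :=
  square_zero /\ forall x y, jac x y (x ** y) = 0.

Definition malcev : Prop :=
  square_zero /\ forall x y z, jac x y (x ** z) = jac x y z ** x.

Definition lie : Prop :=
  square_zero /\ forall x y z, jac x y z = 0.

Definition variety_w : Prop :=
  square_zero /\ forall x y z u, jac x y (z ** u) = 0.

End Identities.

Arguments square_zero {k} A.
Arguments binary_lie {k} A.
Arguments malcev {k} A.
Arguments lie {k} A.
Arguments variety_w {k} A.

Section Subalgebras.
Variables (k : fieldType) (A : algebra k).

Definition subalgebra_closed (S : set A) : Prop :=
  [/\ S 0,
      forall (a : k) (x y : A), S x -> S y -> S (a *: x + y)
    & forall x y : A, S x -> S y -> S (x ** y)].

Record subalgebra := Subalgebra {
  subalg_set : set A;
  subalg_closed : subalgebra_closed subalg_set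
}.

Lemma generated_closed (G : set A) :
  subalgebra_closed (smallest subalgebra_closed G).
Proof.
split=> [M [[]]//|a x y Sx Sy M MG|x y Sx Sy M MG]; have [[_ lM mM] _] := MG.
  by apply: lM; [apply: Sx | apply: Sy].
by apply: mM; [apply: Sx | apply: Sy].
Qed.

Definition generated (G : set A) : subalgebra :=
  Subalgebra (generated_closed G).

End Subalgebras.

(* A subalgebra as an algebra in its own right: the subtype of its elements,
   with the vector space structure and the product inherited from A. *)
Section SubalgebraAsAlgebra.
Variables (k : fieldType) (A : algebra k) (S : subalgebra A).

Definition subalg_pred : {pred A} := fun x => `[< subalg_set S x >].

Fact subalg_pred_submod : submod_closed subalg_pred.
Proof.
have [S0 lS _] := subalg_closed S.
split=> [|a x y /asboolP Sx /asboolP Sy]; apply/asboolP => //; exact: lS.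
Qed.

HB.instance Definition _ :=
  GRing.isSubmodClosed.Build k A subalg_pred subalg_pred_submod.

Record subalg_type := SubalgElt {
  subalg_val : A;
  subalg_valP : subalg_val \in subalg_pred
}.

HB.instance Definition _ := [isSub for subalg_val].
HB.instance Definition _ := [Choice of subalg_type by <:].
HB.instance Definition _ := [SubChoice_isSubLmodule of subalg_type by <:].

Fact subalg_mul_subproof (x y : subalg_type) :
  subalg_val x ** subalg_val y \in subalg_pred.
Proof.
have [_ _ mS] := subalg_closed S.
by apply/asboolP; apply: mS; apply/asboolP; apply: subalg_valP.
Qed.

Definition subalg_mul (x y : subalg_type) : subalg_type :=
  SubalgElt (subalg_mul_subproof x y).

Fact subalg_mul_bilinear :
  bilinear_for (GRing.Scale.Law.clone _ _ *:%R _)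
    (GRing.Scale.Law.clone _ _ *:%R _) subalg_mul.
Proof.
split=> [z|z] a x y; apply: val_inj; rewrite !linearP /=.
  by rewrite linearPl.
by rewrite linearPr.
Qed.

HB.instance Definition _ :=
  bilinear_isBilinear.Build k subalg_type subalg_type subalg_type _ _
    subalg_mul subalg_mul_bilinear.

Definition algebra_of_subalgebra : algebra k :=
  @NonassocAlgebra k subalg_type subalg_mul.

End SubalgebraAsAlgebra.

Coercion algebra_of_subalgebra : subalgebra >-> algebra.

(* Main.v *)
Require Import Defs.
From HB Require Import structures.
From mathcomp Require Import all_boot all_order all_algebra.
From mathcomp Require Import boolp classical_sets.
From mathcomp Require Import ring.

(** The identity [J(x,y,zu) = 0] contains [J(x,y,xy) = 0], so the algebras in
question are Binary-Lie.

For the Moufang property, fix [x] and [y]: since [J] is linear in its last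
argument and kills all products there, [{z | J(x,y,z) = 0}] is not merely a
subspace but a subalgebra ([jac_kernel_closed]).  As [J] is cyclically
invariant, the vanishing of [J] on triples from a set [G] can therefore be
propagated to the subalgebra generated by [G], one argument at a time
([jac_generated]).  For [G = {x1, x2, x3}], the Jacobian is alternating, so
on triples from [G] it is [0] or [+- J(x1,x2,x3)].

For the non-Malcev example, take an alternating form [B] on a vector space, a
vector [e], and the product [xy = B(x,y) e].  With [l(x) = B(e,x)] one finds
[J(x,y,z) = (B(x,y) l(z) + B(y,z) l(x) + B(z,x) l(y)) e].  If [z] is a multiple
of [e], the three terms cancel, as [l(e) = 0]; so every such algebra satisfies
[J(x,y,zu) = 0].  In particular the left side of the Malcev identity
[J(x,y,xz) = J(x,y,z)x] is always [0], while the right side need not be: on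
[k^4] with basis [x, y, z, e], the products [yz = e], [ex = e] (all other products of basis vectors being zero up
to anticommutativity) give [J(x,y,z) = e] and [J(x,y,z)x = e]. *)

Local Open Scope classical_set_scope.
Local Open Scope ring_scope.

Import GRing.Theory.

(** * The Jacobian of an anticommutative algebra *)

Section Jacobian.
Variables (k : fieldType) (A : algebra k).
Implicit Types x y z : A.

Lemma jacC x y z : jac x y z = jac y z x.
Proof. by rewrite /jac [RHS]addrC addrA. Qed.

Lemma jac_linear x y (a : k) z t :
  jac x y (a *: z + t) = a *: jac x y z + jac x y t.
Proof.
rewrite /jac linearPr linearPr linearPl linearPl /= linearPl.
by rewrite !scalerDr [RHS]addrACA; congr (_ + _); exact: addrACA.
Qed.

Lemma jac0 x y : jac x y 0 = 0.
Proof.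
by have := jac_linear x y (-1) 0 0; rewrite scaler0 addr0 scaleN1r addNr.
Qed.

Hypothesis sq0 : square_zero A.

Lemma mul_anticomm x y : x ** y = - (y ** x).
Proof.
apply/eqP; rewrite -addr_eq0; apply/eqP.
have := sq0 (x + y).
by rewrite linearDl /= !linearDr /= !sq0 add0r addr0.
Qed.

Lemma jac_xx x y : jac x x y = 0.
Proof.
by rewrite /jac sq0 linear0l add0r (mul_anticomm y x) linearNl /= subrr.
Qed.

Lemma jac_swap x y z : jac y x z = - jac x y z.
Proof.
rewrite /jac (mul_anticomm y x) (mul_anticomm x z) (mul_anticomm z y).
by rewrite !linearNl /= !opprD addrAC.
Qed.

(** Up to cyclic rotation and a swap of its first two entries, a triple from
[{x1, x2, x3}] is [(x1, x2, x3)] or begins with a repeated entry. *)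
Lemma jac_triple (x1 x2 x3 : A) : jac x1 x2 x3 = 0 ->
  forall x y z, [set x1; x2; x3] x -> [set x1; x2; x3] y ->
    [set x1; x2; x3] z -> jac x y z = 0.
Proof.
move=> J0.
have jxyx (u v : A) : jac u v u = 0 by rewrite -jacC jac_xx.
have jxyy (u v : A) : jac u v v = 0 by rewrite jacC jac_xx.
have J1 : jac x2 x3 x1 = 0 by rewrite -jacC.
have J2 : jac x3 x1 x2 = 0 by rewrite jacC.
move=> x y z [[->|->]|->] [[->|->]|->] [[->|->]|->] //;
  by rewrite ?jac_xx ?jxyx ?jxyy // jac_swap ?J0 ?J1 ?J2 oppr0.
Qed.

End Jacobian.

(** * Moufang property *)

Section Moufang.
Variables (k : fieldType) (A : algebra k).
Hypothesis wA : variety_w A.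

(** Closure under products is where the identity [J(x,y,zu) = 0] enters: any
product lies in the kernel, whatever its factors. *)
Lemma jac_kernel_closed (x y : A) :
  subalgebra_closed [set z | jac x y z = 0].
Proof.
have [_ Jw] := wA; split=> [|a z t /= z0 t0|z t _ _] /=.
- exact: jac0.
- by rewrite jac_linear z0 t0 scaler0 addr0.
- exact: Jw.
Qed.

Lemma jac_generated (G : set A) :
  (forall x y z, G x -> G y -> G z -> jac x y z = 0) ->
  forall x y z, subalg_set (generated G) x -> subalg_set (generated G) y ->
    subalg_set (generated G) z -> jac x y z = 0.
Proof.
move=> G0.
have step (u v : A) : (forall t, G t -> jac u v t = 0) ->
    forall t, subalg_set (generated G) t -> jac u v t = 0.
  move=> Gt t Ct; apply: (Ct [set w | jac u v w = 0]).
  by split; [exact: jac_kernel_closed | exact: Gt].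
(* Each application of [jacC] rotates the next argument still confined to [G]
   into the last position. *)
move=> x y z Cx Cy Cz.
apply: (step _ _ _ _ Cz) => t Gt; rewrite -jacC.
apply: (step _ _ _ _ Cy) => s Gs; rewrite -jacC.
by apply: (step _ _ _ _ Cx) => r Gr; apply: G0.
Qed.

End Moufang.

Lemma subalgebra_lie (k : fieldType) (A : algebra k) (S : subalgebra A) :
  square_zero A ->
  (forall x y z : A, subalg_set S x -> subalg_set S y -> subalg_set S z ->
     jac x y z = 0) ->
  lie S.
Proof.
move=> sq0 J0; split=> [x|x y z]; apply: val_inj; first exact: sq0.
by apply: J0; apply/asboolP; apply: subalg_valP.
Qed.

(** * A non-Malcev algebra *)

Section RankOne.
Variables (k : fieldType) (V : lmodType k) (B : V -> V -> k) (e : V).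
Hypothesis B_linl : forall a x y z, B (a *: x + y) z = a * B x z + B y z.
Hypothesis B_linr : forall a x y z, B z (a *: x + y) = a * B z x + B z y.
Hypothesis B_alt : forall x, B x x = 0.

Definition rank_one_mul (x y : V) : V := B x y *: e.

Fact rank_one_mul_bilinear :
  bilinear_for (GRing.Scale.Law.clone _ _ *:%R _)
    (GRing.Scale.Law.clone _ _ *:%R _) rank_one_mul.
Proof.
by split=> z a x y; rewrite /rank_one_mul /= ?B_linl ?B_linr scalerDl scalerA.
Qed.

HB.instance Definition _ :=
  bilinear_isBilinear.Build k V V V _ _ rank_one_mul rank_one_mul_bilinear.

Definition rank_one_algebra : algebra k := @NonassocAlgebra k V rank_one_mul.

Let BZl a x y : B (a *: x) y = a * B x y.
Proof.
have B0 : B 0 y = 0.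
  by have := B_linl (-1) 0 0 y; rewrite scaler0 addr0 mulN1r addNr.
by have := B_linl a x 0 y; rewrite !addr0 B0 addr0.
Qed.

Let B_antisym x y : B x y = - B y x.
Proof.
apply/eqP; rewrite -addr_eq0; apply/eqP.
have := B_alt (1 *: x + y).
by rewrite B_linl !B_linr !B_alt !mul1r add0r addr0.
Qed.

Lemma rank_one_jac (x y z : rank_one_algebra) :
  jac x y z = (B x y * B e z + B y z * B e x + B z x * B e y) *: e.
Proof. by rewrite /jac /= /rank_one_mul !BZl !scalerDl. Qed.

Lemma rank_one_variety_w : variety_w rank_one_algebra.
Proof.
split=> [x|x y z u]; first by rewrite /= /rank_one_mul B_alt scale0r.
rewrite rank_one_jac /= /rank_one_mul !(B_antisym _ (_ *: e)) !BZl.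
(* What remains, up to the factor [B z u], is [- l(y) l(x) + l(x) l(y)]. *)
rewrite B_alt; set c := (X in X *: _); suff -> : c = 0 by rewrite scale0r.
by rewrite /c; ring.
Qed.

End RankOne.

(** In the basis [x, y, z, e] of [k^4] indexed by [0, 1, 2, 3], this is the
alternating form [y* /\ z* + e* /\ x*]. *)
Definition form4 {k : fieldType} (u v : 'rV[k]_4) : k :=
  (u 0 1 * v 0 2%:R - u 0 2%:R * v 0 1) + (u 0 3%:R * v 0 0 - u 0 0 * v 0 3%:R).

Lemma exists_non_malcev (k : fieldType) :
  exists A : algebra k, variety_w A /\ ~ malcev A.
Proof.
have linl a (x y z : 'rV[k]_4) :
    form4 (a *: x + y) z = a * form4 x z + form4 y z.
  by rewrite /form4 !mxE; ring.
have linr a (x y z : 'rV[k]_4) :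
    form4 z (a *: x + y) = a * form4 z x + form4 z y.
  by rewrite /form4 !mxE; ring.
have alt (x : 'rV[k]_4) : form4 x x = 0 by rewrite /form4; ring.
pose b i : 'rV[k]_4 := delta_mx 0 i.
pose A := rank_one_algebra k _ form4 (b 3%:R) linl linr.
have wA : variety_w A by exact: rank_one_variety_w.
exists A; split=> // -[_ mA].
have [_ wJ] := wA.
have := mA (b 0) (b 1) (b 2%:R); rewrite wJ rank_one_jac.
move=> /(congr1 (fun w : 'rV[k]_4 => w 0 3%:R)) /eqP.
rewrite /= /rank_one_mul /form4 !mxE /=.
by rewrite !(mulr0, mul0r, mulr1, oppr0, add0r, addr0) eq_sym oner_eq0.
Qed.

Theorem theorem1 (k : fieldType) :
  (forall A : algebra k, variety_w A -> binary_lie A) /\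
  (exists A : algebra k, variety_w A /\ ~ malcev A) /\
  (forall A : algebra k, variety_w A ->
     forall x1 x2 x3 : A, jac x1 x2 x3 = 0 ->
       lie (generated [set x1; x2; x3])).
Proof.
split; first by move=> A [sq0 Jw]; split.
split; first exact: exists_non_malcev.
move=> A wA x1 x2 x3 J0; have [sq0 _] := wA.
apply: subalgebra_lie => //; apply: jac_generated => //.
exact: jac_triple.
Qed.
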